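(* Let $\lambda\in\mathbb{C}$, $\lambda\neq 0$, let $H=\lambda xy+H_*$ with $H_*\in\mathcal{F}$, and let $N(x,y)=\nu(xy)$ be the normal form of $H$, where $$\nu(z)=\lambda z+N_*(z),\qquad N_*(z)=N_2z^2+N_3z^3+\ldots$$ is a formal power series in one variable. Let $S[H]$ be the formal power series in $w$ defined by $$S[H](w)=\sum_{m=1}^\infty\frac{(-1)^{m-1}}{\lambda^{m-1}m!}\,\partial_w^{m-1}\langle H_*^m\rangle .$$ Then the formal power series $w\mapsto \frac{1}{\lambda}\bigl(w-S[H](w/\lambda)\bigr)$ is the compositional inverse of $\nu$.
   Context: One degree of freedom, $n=1$: the phase space is $(\mathbb{C}^2,dy\wedge dx)$. $\mathcal{F}$ is the space of formal power series $G=\sum_{\alpha+\beta\ge 3}G_{\alpha\beta}x^\alpha y^\beta$ with complex coefficients (no convergence is assumed). For $G\in\mathcal{F}$ put $\langle G\rangle=\sum_{\alpha\ge 2}G_{\alpha\alpha}w^\alpha$, a formal power series in $w$. $Sym$ is the group of formal symplectic transformations of $(\mathbb{C}^2,dy\wedge dx)$ fixing $0$ with identity differential at $0$; by definition, any element of $Sym$ is the time-one map of a Hamiltonian system $\dot x=\partial F/\partial y$, $\dot y=-\partial F/\partial x$, where $F=F(x,y,t)=O_3(x,y)$ is a formal Taylor series in $x,y$ whose coefficients are continuous in $t\in[0,1]$. A normal form of $H$ is a series $N=H\circ\Phi$ with $\Phi\in Sym$ such that $N-\lambda xy\in\mathcal{F}$ contains only monomials $x^\alpha y^\alpha$; thus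 $N(x,y)=\nu(xy)$. *)

(* Defs.v *)
From HB Require Import structures.
From mathcomp Require Import all_boot all_order all_algebra.
From mathcomp Require Import complex.
From mathcomp Require Import all_classical all_reals all_analysis.

Set Implicit Arguments.
Unset Strict Implicit.
Unset Printing Implicit Defensive.

Import Order.TTheory GRing.Theory Num.Theory.
Import numFieldNormedType.Exports.

Local Open Scope classical_set_scope.
Local Open Scope ring_scope.

(** Formal power series are coefficient functions: [f k] is the coefficient of
    [w^k], and [G a b] is the coefficient of [x^a y^b].  The ring operations on
    series are defined below; the pointwise product of functions plays no role. *)
Definition fps (K : Type) : Type := nat -> K.
Definition fps2 (K : Type) : Type := nat -> nat -> K.

Section OneVariable.
Variable K : fieldType.
Implicit Types f g : fps K.

Definition fps_one : fps K := fun k => (k == 0%N)%:R.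
Definition fps_var : fps K := fun k => (k == 1%N)%:R.
Definition fps_sub f g : fps K := fun k => f k - g k.
Definition fps_scale (c : K) f : fps K := fun k => c * f k.
Definition fps_mul f g : fps K := fun k => \sum_(i < k.+1) f i * g (k - i)%N.
Definition fps_pow f (n : nat) : fps K := iter n (fps_mul f) fps_one.
Definition fps_deriv f : fps K := fun k => f k.+1 *+ k.+1.

(** The series [w |-> f (c w)]. *)
Definition fps_dilate (c : K) f : fps K := fun k => c ^+ k * f k.

(** [f \o g], only meaningful if [g 0 = 0]: then [g^i] has order at least [i],
    so the terms with [i > k] do not contribute to the coefficient of [w^k]. *)
Definition fps_comp f g : fps K :=
  fun k => \sum_(i < k.+1) f i * fps_pow g i k.

Definition fps_comp_inverse f g : Prop :=
  [/\ f 0%N = 0, g 0%N = 0,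
      fps_comp f g = fps_var & fps_comp g f = fps_var].

(** The formal sum of [u m] over [m >= 1]: each coefficient is the eventual
    value of the corresponding coefficient of the partial sums (and 0 by
    convention if that coefficient does not stabilise). *)
Definition fps_sum (u : nat -> fps K) : fps K := fun k =>
  xget 0 [set c : K | \forall n \near \oo, \sum_(1 <= m < n) u m k = c].

End OneVariable.

Arguments fps_var {K}.

Section TwoVariables.
Variable K : fieldType.
Implicit Types G L : fps2 K.

Definition fps2_one : fps2 K := fun a b => ((a == 0%N) && (b == 0%N))%:R.
Definition fps2_x : fps2 K := fun a b => ((a == 1%N) && (b == 0%N))%:R.
Definition fps2_y : fps2 K := fun a b => ((a == 0%N) && (b == 1%N))%:R.
Definition fps2_add G L : fps2 K := fun a b => G a b + L a b.
Definition fps2_opp G : fps2 K := fun a b => - G a b.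
Definition fps2_scale (c : K) G : fps2 K := fun a b => c * G a b.
Definition fps2_mul G L : fps2 K := fun a b =>
  \sum_(i < a.+1) \sum_(j < b.+1) G i j * L (a - i)%N (b - j)%N.
Definition fps2_pow G (n : nat) : fps2 K := iter n (fps2_mul G) fps2_one.
Definition fps2_dx G : fps2 K := fun a b => G a.+1 b *+ a.+1.
Definition fps2_dy G : fps2 K := fun a b => G a b.+1 *+ b.+1.

(** [O_3(x, y)], the space F. *)
Definition O3 G : Prop := forall a b : nat, (a + b < 3)%N -> G a b = 0.

(** A formal map [(x, y) |-> (X (x, y), Y (x, y))] is the pair [(X, Y)]. *)
Definition formal_map : Type := (fps2 K * fps2 K)%type.

Definition fixes_origin (Phi : formal_map) : Prop :=
  Phi.1 0%N 0%N = 0 /\ Phi.2 0%N 0%N = 0.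

Definition identity_differential (Phi : formal_map) : Prop :=
  [/\ Phi.1 1%N 0%N = 1, Phi.1 0%N 1%N = 0,
      Phi.2 1%N 0%N = 0 & Phi.2 0%N 1%N = 1].

(** [dY /\ dX = dy /\ dx], that is, the Jacobian determinant is 1. *)
Definition symplectic (Phi : formal_map) : Prop :=
  fps2_add (fps2_mul (fps2_dx Phi.1) (fps2_dy Phi.2))
    (fps2_opp (fps2_mul (fps2_dy Phi.1) (fps2_dx Phi.2))) = fps2_one.

(** [G \o Phi], only meaningful if [Phi] fixes the origin: then [X^i Y^j] has
    order at least [i + j], so only the terms with [i + j <= a + b] contribute
    to the coefficient of [x^a y^b]. *)
Definition fps2_comp G (Phi : formal_map) : fps2 K := fun a b =>
  \sum_(i < (a + b).+1) \sum_(j < (a + b).+1)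
    G i j * fps2_mul (fps2_pow Phi.1 i) (fps2_pow Phi.2 j) a b.

(** The average [<G>], as a series in [w]. *)
Definition average G : fps K := fun k => if (2 <= k)%N then G k k else 0.

(** The series [nu (x y)]. *)
Definition of_xy (nu : fps K) : fps2 K := fun a b => if a == b then nu a else 0.

(** [lam x y]. *)
Definition quadratic (lam : K) : fps2 K :=
  fps2_scale lam (fps2_mul fps2_x fps2_y).

(** [S[H]] for [H = lam x y + Hs]. *)
Definition Sseries (lam : K) (Hs : fps2 K) : fps K :=
  fps_sum (fun m =>
    fps_scale ((-1) ^+ m.-1 / (lam ^+ m.-1 * (m`!)%:R))
      (iter m.-1 (@fps_deriv K) (average (fps2_pow Hs m)))).

End TwoVariables.

Arguments fps2_x {K}.
Arguments fps2_y {K}.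

Section Dynamics.
Variable R : realType.

Definition continuous_on01 (f : R -> R[i]) : Prop :=
  {within `[0, 1], continuous (fun t => complex.Re (f t))} /\
  {within `[0, 1], continuous (fun t => complex.Im (f t))}.

Definition has_time_derivative (f : R -> R[i]) (t : R) (d : R[i]) : Prop :=
  is_derive t (1 : R) (fun s => complex.Re (f s)) (complex.Re d) /\
  is_derive t (1 : R) (fun s => complex.Im (f s)) (complex.Im d).

(** [Phi] is the time-one map of [x' = dF/dy], [y' = - dF/dx], the equations
    being understood coefficient by coefficient.  The flow is continuous on
    [0, 1] and satisfies the equations on the open interval; as the right-hand
    sides are continuous on [0, 1], the one-sided equations at the endpoints
    follow. *)
Definition time_one_map (F : R -> fps2 R[i]) (Phi : formal_map R[i]) : Prop :=
  exists flow : R -> formal_map R[i],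
    [/\ flow 0 = (fps2_x, fps2_y),
        flow 1 = Phi,
        forall t : R, 0 <= t <= 1 -> fixes_origin (flow t),
        forall a b : nat,
          continuous_on01 (fun t => (flow t).1 a b) /\
          continuous_on01 (fun t => (flow t).2 a b) &
        forall (t : R) (a b : nat), 0 < t < 1 ->
          has_time_derivative (fun s => (flow s).1 a b) t
            (fps2_comp (fps2_dy (F t)) (flow t) a b) /\
          has_time_derivative (fun s => (flow s).2 a b) t
            (fps2_opp (fps2_comp (fps2_dx (F t)) (flow t)) a b)].

Definition Sym (Phi : formal_map R[i]) : Prop :=
  [/\ fixes_origin Phi, identity_differential Phi, symplectic Phi &
      exists F : R -> fps2 R[i],
        [/\ forall t : R, 0 <= t <= 1 -> O3 (F t),
            forall a b : nat, continuous_on01 (fun t => F t a b) &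
            time_one_map F Phi]].

Definition normal_form (lam : R[i]) (H N : fps2 R[i]) : Prop :=
  exists Phi : formal_map R[i],
    [/\ Sym Phi,
        N = fps2_comp H Phi,
        O3 (fps2_add N (fps2_opp (quadratic lam))) &
        forall a b : nat, a != b ->
          fps2_add N (fps2_opp (quadratic lam)) a b = 0].

End Dynamics.

(* Main.v *)
Require Import Defs.
From mathcomp Require Import all_boot all_order all_algebra.
From mathcomp Require Import complex.
From mathcomp Require Import all_classical all_reals all_analysis.
From mathcomp Require Import ring zify.

Set Implicit Arguments.
Unset Strict Implicit.
Unset Printing Implicit Defensive.

Import Order.TTheory GRing.Theory Num.Theory.
Local Open Scope ring_scope.

(** The formal Laplace integral of [f exp (- P / h)], for [P = lam x y + Ps],
    is defined by expanding [exp (- Ps / h)] and integrating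
    [(x y)^a exp (- lam x y / h)] to [a! (h / lam)^(a + 1)]; the coefficient of
    [h^(k + 1)] is the finite sum [L_k f = \sum_m weight m k [(x y)^(m + k)] (f Ps^m)].
    It satisfies integration by parts, [L_k (D f) = L_(k + 1) (f D P)].

    For [f = 1] and [P = H], the numbers [L_k 1 / (k + 1)!] are the coefficients
    of [(w - S[H](w / lam)) / lam].  They do not change when [H] is replaced by
    [H \o Phi]: along the homotopy [Phi_eps = Phi (eps x, eps y) / eps], which
    has Jacobian 1 and joins the identity to [Phi], the derivative
    of [P = H \o Phi_eps] in [eps] is [V . grad P] for a divergence-free field
    [V], so that the derivative of [L_k 1] is [- L_(k + 1) (V . grad P)
    = - L_k (div V) = 0].

    For a normal form the integral is one-dimensional, and integration by parts
    gives [L_k ((nu^j)') = j!] if [j = k + 1] and 0 otherwise.  So the series [g]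
    with [g_(k + 1) = L_k 1 / (k + 1)!] satisfies [L_k ((g \o nu)' - 1) = 0] for
    all [k], whence [g \o nu] is the identity, as [L] is triangular in the
    coefficients of its argument. *)

(** * Formal Laplace integrals *)

Section Laplace.
Context {K : numFieldType}.
Variable lam : K.
Hypothesis lam_neq0 : lam != 0.

(** The factor [(-1)^m / m!] comes from [exp (- Ps / h)] and [(m + k)! / lam^(m + k + 1)] from
    integrating [(x y)^(m + k)]; the powers of [h] combine to [h^(k + 1)]. *)
Definition weight (m k : nat) : K :=
  (-1) ^+ m / m`!%:R / lam ^+ (m + k).+1 * (m + k)`!%:R.

(** The integral of [(x y)^(a + 1)] is [(a + 1) h / lam] times that of [(x y)^a]; here
    [a = m + k]. *)
Lemma weight_up m k : weight m k *+ (m + k).+1 = lam * weight m k.+1.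
Proof.
rewrite /weight addnS factS natrM -mulr_natr.
have fact_neq0 : m`!%:R != 0 :> K by rewrite pnatr_eq0 -lt0n fact_gt0.
rewrite [lam ^+ (m + k).+2]exprS.
have := expf_neq0 (m + k).+1 lam_neq0; set l := lam ^+ _ => l_neq0.
by field; rewrite fact_neq0 l_neq0 lam_neq0.
Qed.

(** Reflects that differentiating the term [m + 1] of [exp (- Ps / h)] gives [- D Ps / h] times the
    term [m]. *)
Lemma weight_shift m k : weight m.+1 k *+ m.+1 = - weight m k.+1.
Proof.
rewrite /weight addnS addSn factS natrM -mulr_natr exprS.
have fact_neq0 : m`!%:R != 0 :> K by rewrite pnatr_eq0 -lt0n fact_gt0.
have := expf_neq0 (m + k).+2 lam_neq0; set l := lam ^+ _ => l_neq0.
have m1_neq0 : m.+1%:R != 0 :> K by rewrite pnatr_eq0.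
by field; rewrite fact_neq0 l_neq0 addrC natr1 m1_neq0.
Qed.

Variables (T : lmodType K) (A : comNzRingType) (phi : nat -> {additive A -> T}).
Variable Ps : A.

(** The map [phi a] stands for the extraction of the coefficient of [z^a], with [z = 'X] in one
    variable and [z = x y] in two, so that integration by parts is proved once for both. The cut-off
    [M] is chosen so large that the order of [Ps^m] makes the later terms vanish. *)
Definition laplace (M k : nat) (f : A) : T :=
  \sum_(m < M) weight m k *: phi (m + k) (f * Ps ^+ m).

Lemma laplaceD M k : {morph laplace M k : f g / f + g}.
Proof.
move=> f g; rewrite /laplace -big_split; apply: eq_bigr => m _ /=.
by rewrite mulrDl raddfD scalerDr.
Qed.

Lemma laplace0 M k : laplace M k 0 = 0.
Proof. by rewrite /laplace big1 // => m _; rewrite mul0r raddf0 scaler0. Qed.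

Definition derivation (D : A -> A) := forall f g, D (f * g) = D f * g + f * D g.

Lemma derivation_exp (D : A -> A) f n : derivation D ->
  D (f ^+ n.+1) = (f ^+ n * D f) *+ n.+1.
Proof.
move=> DM; elim: n => [|n IH]; first by rewrite expr0 mul1r.
by rewrite [in LHS]exprS DM IH mulrnAr mulrA -exprS [D f * _]mulrC -mulrS.
Qed.

(** Apply the product rule to [f * Ps^m]. By [phiD] and [weight_up] the total derivative yields the
    part with [l * D z]; by [weight_shift] the terms in [D (Ps^m)] yield the part with [D Ps]. Here
    [l] is the scalar [lam] seen in [A]. *)
Lemma laplace_ibp (D : {additive A -> A}) (z l f : A) M k :
  derivation D ->
  (forall a g, phi a (D g) = phi a.+1 (g * D z) *+ a.+1) ->
  (forall a g, phi a (l * g) = lam *: phi a g) ->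
  phi (M + k).+1 (f * D Ps * Ps ^+ M) = 0 ->
  laplace M.+1 k (D f) = laplace M.+1 k.+1 (f * (l * D z + D Ps)).
Proof.
move=> DM phiD phil boundary.
have -> : laplace M.+1 k.+1 (f * (l * D z + D Ps)) =
    (\sum_(m < M.+1) lam *: (weight m k.+1 *: phi (m + k).+1 (f * D z * Ps ^+ m)))
    + \sum_(m < M) weight m k.+1 *: phi (m + k).+1 (f * D Ps * Ps ^+ m).
  rewrite mulrDr laplaceD; congr (_ + _).
    apply: eq_bigr => m _.
    have -> : f * (l * D z) * Ps ^+ m = l * (f * D z * Ps ^+ m) by ring.
    by rewrite phil addnS !scalerA mulrC.
  (* Shifting [m] will produce [M] terms only; [boundary] removes the surplus term [m = M]. *)
  rewrite [LHS]big_ord_recr /= addnS boundary scaler0 addr0.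
  by apply: eq_bigr => m _; rewrite addnS.
have term m : weight m k *: phi (m + k) (D f * Ps ^+ m) =
   lam *: (weight m k.+1 *: phi (m + k).+1 (f * D z * Ps ^+ m))
   - weight m k *: phi (m + k) (f * D (Ps ^+ m)).
  have -> : D f * Ps ^+ m = D (f * Ps ^+ m) - f * D (Ps ^+ m) by rewrite DM addrK.
  rewrite raddfB scalerBr phiD; congr (_ - _).
  by rewrite -scalerMnr scalerMnl weight_up scalerA mulrAC.
rewrite {1}/laplace (eq_bigr _ (fun (m : 'I__) _ => term m)) sumrB; congr (_ + _).
(* The term [m = 0] contains [D 1 = 0]; the others are shifted down by one. *)
rewrite big_ord_recl expr0.
have -> : D 1 = 0.
  have := DM 1 1; rewrite !mulr1 mul1r => /eqP; rewrite -subr_eq subrr.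
  by move=> /eqP <-.
rewrite mulr0 raddf0 scaler0 add0r -sumrN; apply: eq_bigr => m _.
rewrite /= derivation_exp // mulrnAr raddfMn -scalerMnr scalerMnl weight_shift.
by rewrite scaleNr opprK addSn mulrCA -mulrA mulrC mulrA.
Qed.

End Laplace.

(** * Inversion in one variable *)

Section OneVariableInversion.
Context {K : numFieldType}.
Implicit Types f g p q : {poly K}.

Definition vanish1 (d : nat) p := forall i, (i < d)%N -> p`_i = 0.

Lemma vanish1_0 p : vanish1 0 p.
Proof. by []. Qed.

Lemma vanish1M d e p q : vanish1 d p -> vanish1 e q -> vanish1 (d + e) (p * q).
Proof.
move=> hp hq i hi; rewrite coefM big1 // => j _.
have [hj|hj] := ltnP j d; first by rewrite hp ?mul0r.
by rewrite hq ?mulr0 //; have := ltn_ord j; lia.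
Qed.

Lemma vanish1X d p n : vanish1 d p -> vanish1 (d * n) (p ^+ n).
Proof.
move=> hp; elim: n => [|n IH]; first by move=> i; rewrite muln0.
by rewrite exprS mulnS; apply: vanish1M.
Qed.

Variables (lam : K) (Ns : {poly K}).
Hypotheses (lam_neq0 : lam != 0) (Ns2 : vanish1 2 Ns).

Let nu := lam *: 'X + Ns.
Let phi (a : nat) : {additive {poly K} -> K^o} := coefp a.
Let L := laplace lam phi Ns.

Let nu'E : deriv nu = lam%:P * deriv 'X + deriv Ns.
Proof. by rewrite /nu derivD derivZ mul_polyC. Qed.

Let vanish1_deriv : vanish1 1 (deriv Ns).
Proof. by move=> i hi; rewrite coef_deriv Ns2 ?mul0rn. Qed.

Let nu1 : vanish1 1 nu.
Proof.
by case=> // _; rewrite /nu coefD coefZ coefX Ns2 // mulr0 addr0.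
Qed.

Let L_ibp M k f : (k < M)%N -> L M.+1 k (deriv f) = L M.+1 k.+1 (f * deriv nu).
Proof.
move=> kM; rewrite nu'E; apply: laplace_ibp => //.
- exact: derivM.
- by move=> a g; rewrite /= derivX mulr1 coef_deriv.
- by move=> a g /=; rewrite coefCM.
(* The order of [f * Ns' * Ns^M] is at least [2 M + 1], above the index [M + k + 1] since
   [k < M]. *)
- have := vanish1M (vanish1M (vanish1_0 f) vanish1_deriv) (vanish1X (n := M) Ns2).
  by apply=> //; lia.
Qed.

Let LZ M k c f : L M k (c *: f) = c * L M k f.
Proof.
rewrite /L /laplace mulr_sumr; apply: eq_bigr => m _ /=.
by rewrite -scalerAl coefZ [in RHS]mulrCA.
Qed.

(** The formal counterpart of integrating [nu^j exp (- nu / h) d nu] to [j! h^(j + 1)]. Integration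
    by parts lowers [k] and [j] together; for [k = 0] only the constant coefficient of [nu^j nu']
    counts. *)
Let L_powM M k j : (k <= M)%N ->
  L M.+1 k (nu ^+ j * deriv nu) = j`!%:R *+ (k == j).
Proof.
elim: k j => [|k IH] j kM.
  rewrite /L /laplace big_ord_recl big1 => [|m _]; last first.
    rewrite /= (vanish1M (vanish1_0 _) (vanish1X Ns2)) ?scaler0 //.
    by rewrite /bump; lia.
  rewrite addr0 /= expr0 mulr1 /weight !expr0 addn0 fact0 coef0M.
  rewrite nu'E derivX mulr1 coefD coefC vanish1_deriv // addr0 /=.
  case: j => [|j].
    rewrite expr0 coefC /= /GRing.scale /= expr1 !divr1 mul1r mulr1 mul1r.
    by rewrite mulVf.
  by rewrite [nu ^+ _]exprS coef0M nu1 // !mul0r scaler0.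
rewrite -L_ibp //.
case: j => [|j]; first by rewrite expr0 derivC /L laplace0.
rewrite deriv_exp /= eqSS -mulr_natr -polyC_natr mulrC mul_polyC LZ.
rewrite [deriv nu * _]mulrC IH; last by lia.
by rewrite factS natrM -mulrnAr.
Qed.

(** Triangularity: if [f] has order at least [n], then [f * Ns^m] with [m >= 1] has order at least
    [n + 2 m > n + m], so [L_n f] is [n! / lam^(n + 1)] times the coefficient [f_n]. *)
Let L_inj n M f : (forall k, (k < n)%N -> L M.+1 k f = 0) -> vanish1 n f.
Proof.
elim: n => [|n IH] Lf; first by [].
have {}IH := IH (fun k kn => Lf k (ltnW kn)).
move=> i; rewrite ltnS leq_eqVlt => /orP[/eqP ->|]; last exact: IH.
have := Lf n (ltnSn n); rewrite /L /laplace big_ord_recl big1 => [|m _]; last first.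
  rewrite /= (vanish1M IH (vanish1X Ns2)) ?scaler0 //.
  by rewrite /bump; lia.
rewrite addr0 /= expr0 mulr1 /weight add0n expr0 fact0 /GRing.scale /= => /eqP.
rewrite !mulf_eq0 !invr_eq0 !oner_eq0 expf_eq0 (negPf lam_neq0) andbF /=.
by rewrite pnatr_eq0 -leqn0 leqNgt fact_gt0 /= => /eqP.
Qed.

(** The sum [S] is a truncation of [g \o nu]. By parts, [L_k S'] keeps only the term [j = k + 1],
    which is [L_k 1]; injectivity of [L] then gives [S' = 1] below degree [n]. *)
Lemma laplace_inverse n M (g : nat -> K) : (n <= M)%N -> g 0%N = 0 ->
  (forall k, (k < n)%N -> L M.+1 k 1 = g k.+1 * k.+1`!%:R) ->
  forall i, (i <= n)%N -> (\sum_(j < n.+1) g j *: nu ^+ j)`_i = (i == 1%N)%:R.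
Proof.
move=> nM g0 Lg; set S := \sum_(j < _) _.
have S_deriv : vanish1 n (deriv S - 1).
  apply: (@L_inj n M) => k kn.
  rewrite -scaleN1r /L laplaceD -/L LZ Lg // mulN1r.
  have -> : L M.+1 k (deriv S) = g k.+1 * k.+1`!%:R; last by rewrite subrr.
  rewrite /S [deriv _]raddf_sum.
  rewrite (big_morph (L M.+1 k) (laplaceD _ _ _ _ _) (laplace0 _ _ _ _ _)).
  under eq_bigr => j _ do rewrite /= derivZ LZ.
  rewrite (bigD1 (Ordinal (kn : (k.+1 < n.+1)%N))) //= big1 ?addr0 => [|[[|j] /= jn] jk].
  - by rewrite L_ibp ?L_powM ?eqxx //; lia.
  - by rewrite expr0 derivC /L laplace0 mulr0.
  - rewrite L_ibp ?L_powM; try lia.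
    suff /negPf -> : k.+1 != j.+1 by rewrite mulr0.
    by apply: contra jk => /eqP kj; apply/eqP/val_inj.
case=> [|i] ilen.
  rewrite coef_sum big1 // => -[[|j] jn] _; first by rewrite g0 scale0r coef0.
  by rewrite coefZ exprS coef0M nu1 // mul0r mulr0.
have := S_deriv i ilen; rewrite coefB coef_deriv coef1 => /eqP; rewrite subr_eq0.
rewrite eqSS; case: i ilen => [|i] _ /eqP; first by rewrite mulr1n.
by move/eqP; rewrite mulrn_eq0 /= => /eqP.
Qed.

End OneVariableInversion.

(** * Composition of one-variable series through polynomial truncations *)

Section Composition.
Context {K : numFieldType}.
Implicit Types (f g : fps K) (p q : {poly K}).

(** Series are replaced by polynomials so that the calculations take place in a commutative ring. *)
Definition agree1 (n : nat) f p := forall i, (i < n)%N -> f i = p`_i.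

Lemma agree1_poly n f : agree1 n f (\poly_(i < n) f i).
Proof. by move=> i hi; rewrite coef_poly hi. Qed.

Lemma agree1M n f g p q :
  agree1 n f p -> agree1 n g q -> agree1 n (fps_mul f g) (p * q).
Proof.
move=> fp gq i hi; rewrite /fps_mul coefM; apply: eq_bigr => j _.
by rewrite fp ?gq //; have := ltn_ord j; lia.
Qed.

Lemma agree1X n f p m : agree1 n f p -> agree1 n (fps_pow f m) (p ^+ m).
Proof.
move=> fp; elim: m => [|m IH]; last by rewrite exprS; apply: agree1M.
by move=> i _; rewrite expr0 coef1.
Qed.

(** The bound of the sum on the right does not depend on [k]: the terms with [i > k] vanish because
    [p^i] has order at least [i]. *)
Lemma fps_comp_coef n f g p : agree1 n.+1 g p -> g 0%N = 0 ->
  forall k, (k <= n)%N ->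
  fps_comp f g k = (\sum_(i < n.+1) f i *: p ^+ i)`_k.
Proof.
move=> gp g0 k kn; rewrite coef_sum /fps_comp.
rewrite (big_ord_widen n.+1 (fun i => f i * fps_pow g i k)) //.
rewrite [LHS]big_mkcond; apply: eq_bigr => i _ /=.
rewrite coefZ -(agree1X _ gp) //.
case: ltnP => // ki; rewrite (agree1X _ gp) //.
have p1 : vanish1 1 p by case=> // _; rewrite -gp.
by rewrite (vanish1X p1) ?mulr0 // mul1n.
Qed.

Lemma comp_poly_sum n f p :
  (\poly_(i < n) f i) \Po p = \sum_(i < n) f i *: p ^+ i.
Proof.
rewrite poly_def [LHS]raddf_sum; apply: eq_bigr => i _ /=.
by rewrite comp_polyZ comp_Xn_poly.
Qed.

Lemma vanish1X_coef p i : vanish1 1 p -> (p ^+ i)`_i = p`_1 ^+ i.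
Proof.
move=> p1; elim: i => [|i IH]; first by rewrite !expr0 coef1.
rewrite exprS coefM big_ord_recl p1 // mul0r add0r big_ord_recl /= subn1 IH /=.
rewrite exprS big1 ?addr0 // => j _; rewrite (vanish1X p1) ?mulr0 //.
by rewrite /bump mul1n; have := ltn_ord j; lia.
Qed.

(** If [q] starts with [q_n X^n], then [q \Po p] starts with [q_n p_1^n X^n]. *)
Lemma comp_poly_vanish1 n p q : vanish1 1 p -> p`_1 != 0 ->
  vanish1 n (q \Po p) -> vanish1 n q.
Proof.
move=> p1 p1_neq0; elim: n => [|n IH] qp; first by [].
have {}IH := IH (fun i hi => qp i (ltnW hi)).
move=> i; rewrite ltnS leq_eqVlt => /orP[/eqP ->|]; last exact: IH.
have := qp n (ltnSn n); rewrite comp_polyE coef_sum.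
have [qn|nq] := leqP (size q) n; first by rewrite nth_default.
rewrite (bigD1 (Ordinal nq)) //= big1 => [|j jn]; last first.
  have {}jn : (j : nat) != n by apply: contra jn => /eqP jn; apply/eqP/val_inj.
  have [jn'|jn'] := ltnP j n; first by rewrite coefZ IH ?mul0r.
  by rewrite coefZ (vanish1X p1) ?mulr0 // mul1n; lia.
rewrite addr0 coefZ vanish1X_coef // => /eqP.
by rewrite mulf_eq0 expf_eq0 (negPf p1_neq0) andbF orbF => /eqP.
Qed.

Lemma comp_poly_congr n p q q' :
  (forall i, (i < n)%N -> q`_i = q'`_i) ->
  forall i, (i < n)%N -> (p \Po q)`_i = (p \Po q')`_i.
Proof.
move=> qq' i hi; rewrite !comp_polyE !coef_sum; apply: eq_bigr => j _.
rewrite !coefZ; congr (_ * _).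
have := @agree1X n (fun i => q'`_i) q j (fun i hi => esym (qq' i hi)) i hi.
by move<-; apply: (@agree1X n (fun i => q'`_i) q').
Qed.

(** Modulo high powers, [(f \o g - id) \o f = f \o (g \o f) - f = 0], and [f] can be cancelled on
    the right as its linear coefficient is nonzero. *)
Lemma fps_comp_left_inverse f g : f 0%N = 0 -> g 0%N = 0 -> f 1%N != 0 ->
  fps_comp g f = fps_var -> fps_comp f g = fps_var.
Proof.
move=> f0 g0 f1 gf; apply/funext => k; pose n := k.+1.
pose F := \poly_(i < n.+1) f i; pose G := \poly_(i < n.+1) g i.
have F1 : vanish1 1 F by case=> // _; rewrite coef_poly.
have GF i : (i < n.+1)%N -> (G \Po F)`_i = ('X : {poly K})`_i.
  move=> hi; rewrite /G comp_poly_sum -(fps_comp_coef g (agree1_poly f)) //.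
  by rewrite gf coefX.
have FG : vanish1 n.+1 (F \Po G - 'X).
  apply: (comp_poly_vanish1 F1); first by rewrite coef_poly.
  move=> i hi; rewrite comp_polyB comp_polyX -comp_polyA coefB.
  by rewrite (comp_poly_congr F GF) // comp_polyXr subrr.
have kn : (k < n.+1)%N by rewrite /n.
have := FG k kn; rewrite coefB /F comp_poly_sum coefX => /eqP.
rewrite -(fps_comp_coef f (agree1_poly g)) // subr_eq0.
by move=> /eqP.
Qed.

End Composition.

(** * Coefficientwise derivations and order of vanishing in two variables *)

Lemma derivation_map_poly (S : comNzRingType) (D : {additive S -> S}) :
  derivation D -> derivation (map_poly D : {poly S} -> {poly S}).
Proof.
move=> DM p q; apply/polyP => i.
rewrite coefD !coefM coef_map /= coefM raddf_sum -big_split.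
by apply: eq_bigr => j _; rewrite /= DM !coef_map.
Qed.

Section Vanishing.
Context {S : comNzRingType}.
Implicit Types p q : {poly {poly S}}.

Lemma coef2M p q a b : (p * q)`_a`_b =
  \sum_(i < a.+1) \sum_(j < b.+1) p`_i`_j * q`_(a - i)`_(b - j).
Proof. by rewrite coefM coef_sum; apply: eq_bigr => i _; rewrite coefM. Qed.

(** The order is taken in [x] and [y] only; the parameter [eps] will belong to the coefficient ring
    [S]. *)
Definition vanish2 (d : nat) p := forall a b, (a + b < d)%N -> p`_a`_b = 0.

Lemma vanish2_0 p : vanish2 0 p.
Proof. by []. Qed.

Lemma vanish2W d e p : (e <= d)%N -> vanish2 d p -> vanish2 e p.
Proof. by move=> ed hp a b hab; apply: hp; lia. Qed.

Lemma vanish2D d p q : vanish2 d p -> vanish2 d q -> vanish2 d (p + q).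
Proof. by move=> hp hq a b hab; rewrite !coefD hp ?hq ?addr0. Qed.

Lemma vanish2M d e p q : vanish2 d p -> vanish2 e q -> vanish2 (d + e) (p * q).
Proof.
move=> hp hq a b hab; rewrite coef2M big1 // => i _; rewrite big1 // => j _.
have [hij|hij] := ltnP (i + j) d; first by rewrite hp ?mul0r.
by rewrite hq ?mulr0 //; have := ltn_ord i; have := ltn_ord j; lia.
Qed.

Lemma vanish2X d p n : vanish2 d p -> vanish2 (d * n) (p ^+ n).
Proof.
move=> hp; elim: n => [|n IH]; first by move=> a b; rewrite muln0.
by rewrite exprS mulnS; apply: vanish2M.
Qed.

Lemma vanish2_sum d (I : Type) (r : seq I) (F : I -> {poly {poly S}}) :
  (forall i, vanish2 d (F i)) -> vanish2 d (\sum_(i <- r) F i).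
Proof.
move=> hF a b hab; rewrite !coef_sum big1 // => i _; exact: hF.
Qed.

End Vanishing.

(** * Invariance along the homotopy *)

Section Homotopy.
Context {K : numFieldType}.
(* Polynomials in [x], [y] and the homotopy parameter [eps], from the outside in. *)
Local Notation B := {poly {poly {poly K}}}.

Definition dx : {additive B -> B} := @deriv _.
Definition dy : {additive B -> B} := map_poly (@deriv _).
Definition deps : {additive B -> B} := map_poly (map_poly (@deriv _)).

Definition embed (c : K) : B := c%:P%:P%:P.
Definition xy : B := 'X * ('X)%:P.

Lemma derivation_dx : derivation dx.
Proof. exact: derivM. Qed.

Lemma derivation_dy : derivation dy.
Proof. by apply: derivation_map_poly; exact: derivM. Qed.

Lemma derivation_deps : derivation deps.
Proof.
apply: (@derivation_map_poly _ (map_poly (@deriv _))).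
by apply: derivation_map_poly; exact: derivM.
Qed.

Lemma coef_dx p a b : (dx p)`_a`_b = p`_a.+1`_b *+ a.+1.
Proof. by rewrite /dx /= coef_deriv coefMn. Qed.

Lemma coef_dy p a b : (dy p)`_a`_b = p`_a`_b.+1 *+ b.+1.
Proof. by rewrite /dy /= coef_map /= coef_deriv. Qed.

Lemma coef_deps p a b : (deps p)`_a`_b = deriv (p`_a`_b).
Proof. by rewrite /deps /= coef_map /= coef_map. Qed.

Lemma dx_dy p : dx (dy p) = dy (dx p).
Proof.
apply/polyP => a; apply/polyP => b.
by rewrite coef_dx !coef_dy coef_dx mulrnAC.
Qed.

Lemma dx_deps p : dx (deps p) = deps (dx p).
Proof.
apply/polyP => a; apply/polyP => b.
by rewrite coef_dx !coef_deps coef_dx derivMn.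
Qed.

Lemma dy_deps p : dy (deps p) = deps (dy p).
Proof.
apply/polyP => a; apply/polyP => b.
by rewrite coef_dy !coef_deps coef_dy derivMn.
Qed.

Lemma dx_embed c : dx (embed c) = 0.
Proof. exact: derivC. Qed.

Lemma dy_embed c : dy (embed c) = 0.
Proof. by rewrite /dy /= /embed map_polyC /= derivC. Qed.

Lemma deps_embed c : deps (embed c) = 0.
Proof. by rewrite /deps /= /embed map_polyC /= map_polyC /= derivC. Qed.

Lemma dx_xy : dx xy = ('X)%:P.
Proof. by rewrite /dx /xy /= derivM derivX derivC mulr0 addr0 mul1r. Qed.

Lemma dy_xy : dy xy = 'X.
Proof.
rewrite /xy derivation_dy /dy /= map_polyC /= derivX mulr1.
suff -> : map_poly (@deriv _) ('X : B) = 0 by rewrite mul0r add0r.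
apply/polyP => a; rewrite coef_map /= coefX coef0.
by case: eqP => _; rewrite /= -?polyC1 derivC.
Qed.

Lemma deps_xy : deps xy = 0.
Proof.
apply/polyP => a; apply/polyP => b; rewrite coef_deps /xy coefXM.
case: eqP => _; first by rewrite !coef0 raddf0.
rewrite coefC; case: eqP => _; last by rewrite !coef0 raddf0.
by rewrite coefX !coef0 -polyC_natr derivC.
Qed.

(** The coefficient of [(x y)^a], a polynomial in [eps]; this is [phi] for the two-variable
    integral. *)
Definition diag (a : nat) : {additive B -> {poly K}} := coefp a \o coefp a.

Lemma diagE a p : diag a p = p`_a`_a.
Proof. by []. Qed.

Lemma diag_dx a p : diag a (dx p) = diag a.+1 (p * dx xy) *+ a.+1.
Proof. by rewrite !diagE coef_dx dx_xy coefMC coefMX. Qed.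

Lemma diag_dy a p : diag a (dy p) = diag a.+1 (p * dy xy) *+ a.+1.
Proof. by rewrite !diagE coef_dy dy_xy coefMX. Qed.

Lemma diag_embed c a p : diag a (embed c * p) = c *: diag a p.
Proof. by rewrite !diagE /embed !coefCM mul_polyC. Qed.

Variables (lam : K) (n : nat) (H : nat -> nat -> K) (X Y : B).

Definition pullback : B := \sum_(i < n) \sum_(j < n) embed (H i j) * (X ^+ i * Y ^+ j).

(** [P1] and [P2] are the partial derivatives of [H] evaluated at [(X, Y)]; the multiples [*+ i] and
    [*+ j] cancel the terms where [i.-1] or [j.-1] is 0 by convention. *)
Let P1 : B := \sum_(i < n) \sum_(j < n) embed (H i j) * (X ^+ i.-1 *+ i * Y ^+ j).
Let P2 : B := \sum_(i < n) \sum_(j < n) embed (H i j) * (X ^+ i * (Y ^+ j.-1 *+ j)).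

Lemma chain_rule (D : {additive B -> B}) : derivation D ->
  (forall c, D (embed c) = 0) -> D pullback = P1 * D X + P2 * D Y.
Proof.
move=> DM Dc; rewrite /pullback /P1 /P2 !mulr_suml raddf_sum -big_split.
apply: eq_bigr => i _ /=; rewrite !mulr_suml raddf_sum -big_split.
apply: eq_bigr => j _ /=; rewrite DM Dc mul0r add0r DM.
have DX Z m : D (Z ^+ m) = Z ^+ m.-1 *+ m * D Z.
  case: m => [|m]; last by rewrite derivation_exp // mulrnAl.
  have := Dc 1; rewrite /embed !polyC1 => D1.
  by rewrite expr0 D1 mulr0n mul0r.
by rewrite !DX; ring.
Qed.

Definition jacobian_det : B := dx X * dy Y - dy X * dx Y.

Let Ps := pullback - embed lam * xy.

(** The truncated maps have Jacobian 1 only up to a certain degree, so the vanishing of [div V]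
    holds up to terms too high to reach any coefficient read by [laplace]. *)
Lemma laplace_homotopy M k : lam != 0 -> (2 * k + 3 <= M)%N ->
  vanish2 3 Ps -> vanish2 (2 * (M + k) + 3) (jacobian_det - 1) ->
  deriv (laplace lam diag Ps M.+1 k 1) = 0.
Proof.
move=> lam_neq0 kM Ps3 J1; pose L := laplace lam diag Ps M.+1.
(* The order [3 M] exceeds the degree [2 (M + k + 1)] exactly when [M >= 2 k + 3]. *)
have boundary f : diag (M + k).+1 (f * Ps ^+ M) = 0.
  by rewrite diagE (vanish2M (vanish2_0 f) (vanish2X Ps3)) //; lia.
(* The highest monomial read is [(x y)^(M + k + 1)], of degree [2 (M + k) + 2]. *)
have high f j : (j <= k.+1)%N -> vanish2 (2 * (M + k) + 3) f -> L j f = 0.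
  move=> jk hf; rewrite /L /laplace big1 // => m _.
  rewrite diagE (vanish2M hf (vanish2_0 _)) ?scaler0 //.
  by have := ltn_ord m; lia.
have deps1 : deps 1 = 0 by rewrite -(deps_embed 1) /embed !polyC1.
have dPs (D : {additive B -> B}) : derivation D -> (forall c, D (embed c) = 0) ->
    D pullback = embed lam * D xy + D Ps.
  by move=> DM Dc; rewrite /Ps raddfB (DM (embed lam)) Dc mul0r add0r addrC subrK.
have ibp_x f : L k.+1 (f * dx pullback) = L k (dx f).
  rewrite (dPs _ derivation_dx dx_embed); symmetry.
  apply: laplace_ibp => //; [exact: derivation_dx|exact: diag_dx|exact: diag_embed].
have ibp_y f : L k.+1 (f * dy pullback) = L k (dy f).
  rewrite (dPs _ derivation_dy dy_embed); symmetry.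
  apply: laplace_ibp => //; [exact: derivation_dy|exact: diag_dy|exact: diag_embed].
(* Differentiation of [exp (- Ps / h)] in [eps]: [weight_shift] moves the factor [1 / h] into the
   index [k + 1]. *)
have -> : deriv (L k 1) = - L k.+1 (deps pullback).
  rewrite (dPs _ derivation_deps deps_embed) deps_xy mulr0 add0r.
  have term m : deriv (weight lam m k *: diag (m + k) (1 * Ps ^+ m)) =
      weight lam m k *: diag (m + k) (deps (Ps ^+ m)).
    by rewrite derivZ mul1r !diagE coef_deps.
  rewrite /L /laplace [deriv _]raddf_sum (eq_bigr _ (fun (m : 'I__) _ => term m)).
  rewrite big_ord_recl [in RHS]big_ord_recr.
  have -> : deps (Ps ^+ 0) = 0 by rewrite expr0 deps1.
  rewrite raddf0 scaler0 add0r [nat_of_ord ord_max]/= addnS.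
  rewrite boundary scaler0 Monoid.mulm1 -sumrN.
  apply: eq_bigr => m _; rewrite lift0.
  rewrite (derivation_exp _ _ derivation_deps) raddfMn -scalerMnr scalerMnl.
  by rewrite weight_shift // scaleNr addSn addnS mulrC.
(* [V] is the adjugate of the Jacobian matrix applied to [(deps X, deps Y)]; Cramer's rule turns
   this into [Vgrad]. *)
pose V1 := dy Y * deps X - dy X * deps Y.
pose V2 := dx X * deps Y - dx Y * deps X.
have Vgrad : deps pullback + (jacobian_det - 1) * deps pullback =
    V1 * dx pullback + V2 * dy pullback.
  rewrite (chain_rule derivation_dx dx_embed) (chain_rule derivation_dy dy_embed).
  rewrite (chain_rule derivation_deps deps_embed) /V1 /V2 /jacobian_det; ring.
(* Since mixed derivatives commute, the divergence of [V] is the [eps]-derivative of the Jacobian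
   determinant. *)
have Vdiv : dx V1 + dy V2 = deps (jacobian_det - 1).
  rewrite /V1 /V2 /jacobian_det !raddfB deps1 subr0.
  rewrite !derivation_dx !derivation_dy !derivation_deps.
  rewrite !dx_dy !dx_deps !dy_deps; ring.
have -> : L k.+1 (deps pullback) = 0.
  have LD j : {morph L j : f g / f + g} by exact: laplaceD.
  have high0 : L k.+1 ((jacobian_det - 1) * deps pullback) = 0.
    apply: high => //; rewrite -[X in vanish2 X _]addn0.
    exact: vanish2M J1 (vanish2_0 _).
  have := congr1 (L k.+1) Vgrad; rewrite !LD high0 addr0 ibp_x ibp_y -LD Vdiv => ->.
  by apply: high => // a b hab; rewrite coef_deps J1 // raddf0.
by rewrite oppr0.
Qed.

End Homotopy.

Arguments xy : clear implicits.

(** * Truncated formal maps, their rescaling, and the two ends of the homotopy *)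

Section Invariance.
Context {K : numFieldType}.
Local Notation B := {poly {poly {poly K}}}.
Implicit Types (F G : fps2 K) (p q : B) (e lam : K).

(** Here [e] is a value of [eps]: the homotopy is at the identity for [e = 0] and at [Phi] for
    [e = 1]. *)
Definition agree2 e (n : nat) G p :=
  forall a b, (a + b < n)%N -> G a b = (p`_a`_b).[e].

Lemma agree2M e n F G p q :
  agree2 e n F p -> agree2 e n G q -> agree2 e n (fps2_mul F G) (p * q).
Proof.
move=> Fp Gq a b hab; rewrite /fps2_mul coef2M horner_sum; apply: eq_bigr => i _.
rewrite horner_sum; apply: eq_bigr => j _.
by rewrite hornerM Fp ?Gq //; have := ltn_ord i; have := ltn_ord j; lia.
Qed.

Lemma monomial_coef i j a b :
  ('X^i * ('X)%:P ^+ j : B)`_a`_b = ((a == i) && (b == j))%:R.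
Proof.
rewrite coefXnM -rmorphXn /= coefC.
have [ai|ia] := ltnP a i; first by rewrite coef0 (ltn_eqF ai).
rewrite subn_eq0 [a == i]eqn_leq ia andbT.
by case: leqP => _; rewrite ?coef0 // coefXn.
Qed.

Lemma horner_natb e (b : bool) : (b%:R : {poly K}).[e] = b%:R.
Proof. by rewrite -polyC_natr hornerC. Qed.

Lemma agree2_one e n : agree2 e n (fps2_one K) 1.
Proof.
move=> a b _; have := monomial_coef 0 0 a b; rewrite !expr0 mulr1 => ->.
by rewrite horner_natb.
Qed.

Lemma agree2X e n G p m : agree2 e n G p -> agree2 e n (fps2_pow G m) (p ^+ m).
Proof.
move=> Gp; elim: m => [|m IH]; first exact: agree2_one.
by rewrite exprS; apply: agree2M.
Qed.

Lemma agree2B e n F G p q :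
  agree2 e n F p -> agree2 e n G q -> agree2 e n (fps2_add F (fps2_opp G)) (p - q).
Proof.
by move=> Fp Gq a b hab; rewrite /fps2_add /fps2_opp !coefB hornerD hornerN Fp ?Gq.
Qed.

Lemma agree2_x e n : agree2 e n fps2_x 'X.
Proof.
move=> a b _; have := monomial_coef 1 0 a b; rewrite expr1 expr0 mulr1 => ->.
by rewrite horner_natb.
Qed.

Lemma agree2_y e n : agree2 e n fps2_y ('X)%:P.
Proof.
move=> a b _; have := monomial_coef 0 1 a b; rewrite expr1 expr0 mul1r => ->.
by rewrite horner_natb.
Qed.

Lemma quadraticE lam a b : quadratic lam a b = lam *+ ((a == 1%N) && (b == 1%N)).
Proof.
rewrite /quadratic /fps2_scale.
rewrite (agree2M (@agree2_x 0 _) (@agree2_y 0 _) (ltnSn (a + b))).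
have := monomial_coef 1 1 a b; rewrite !expr1 => ->.
by rewrite horner_natb mulr_natr.
Qed.

Lemma agree2_quadratic e n lam : agree2 e n (quadratic lam) (embed lam * xy K).
Proof.
move=> a b _; rewrite quadraticE /embed !coefCM hornerM hornerC /xy.
have := monomial_coef 1 1 a b; rewrite !expr1 => ->.
by rewrite horner_natb mulr_natr.
Qed.

(* [G (eps x, eps y) / eps] truncated in [x] and [y], for [G] without constant term. *)
Definition rescale (n : nat) G : B :=
  \poly_(a < n) \poly_(b < n) (G a b *: 'X^((a + b).-1)).

Lemma coef_rescale n G a b : (a + b < n)%N ->
  (rescale n G)`_a`_b = G a b *: 'X^((a + b).-1).
Proof.
move=> hab; rewrite coef_poly (leq_ltn_trans (leq_addr b a) hab).
by rewrite coef_poly (leq_ltn_trans (leq_addl a b) hab).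
Qed.

(* [p] is [G (eps x, eps y)] up to total degree [n]. *)
Definition weighted (n : nat) G p :=
  forall a b, (a + b < n)%N -> p`_a`_b = G a b *: 'X^(a + b).

Lemma weightedM n F G p q :
  weighted n F p -> weighted n G q -> weighted n (fps2_mul F G) (p * q).
Proof.
move=> Fp Gq a b hab; rewrite /fps2_mul coef2M scaler_suml; apply: eq_bigr => i _.
rewrite scaler_suml; apply: eq_bigr => j _.
have ha := ltn_ord i; have hb := ltn_ord j.
rewrite Fp ?Gq; try lia.
rewrite -scalerAl -scalerAr scalerA -exprD; congr (_ *: 'X^_); lia.
Qed.

Lemma weighted_dx n G : weighted n.-1 (fps2_dx G) (dx (rescale n G)).
Proof.
move=> a b hab; rewrite coef_dx coef_rescale; last by lia.
by rewrite /fps2_dx addSn /= scalerMnl.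
Qed.

Lemma weighted_dy n G : weighted n.-1 (fps2_dy G) (dy (rescale n G)).
Proof.
move=> a b hab; rewrite coef_dy coef_rescale; last by lia.
by rewrite /fps2_dy addnS /= scalerMnl.
Qed.

(** The first derivatives of [Phi (eps x, eps y) / eps] are those of [Phi] at [(eps x, eps y)],
    hence so is the determinant. Differentiation costs one degree of precision. *)
Lemma jacobian_rescale n (Phi : formal_map K) : symplectic Phi ->
  vanish2 n.-1 (jacobian_det (rescale n Phi.1) (rescale n Phi.2) - 1).
Proof.
move=> J1 a b hab; rewrite /jacobian_det !coefB.
rewrite (weightedM (@weighted_dx n _) (@weighted_dy n _) hab).
rewrite (weightedM (@weighted_dy n _) (@weighted_dx n _) hab).
have := congr1 (fun G => G a b) J1; rewrite /fps2_add /fps2_opp -scalerBl => ->.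
have := monomial_coef 0 0 a b; rewrite !expr0 mulr1 => ->; rewrite /fps2_one.
case: andP => [[/eqP -> /eqP ->]|_]; first by rewrite scale1r expr0 subrr.
by rewrite scale0r subr0.
Qed.

Lemma rescale_vanish n G : G 0%N 0%N = 0 -> vanish2 1 (rescale n.+1 G).
Proof. by move=> G0 [|a] [|b] // _; rewrite coef_rescale // G0 scale0r. Qed.

Lemma agree2_rescale1 n G : agree2 1 n G (rescale n G).
Proof.
by move=> a b hab; rewrite coef_rescale // hornerZ hornerXn expr1n mulr1.
Qed.

Lemma pullback_coef n (H : fps2 K) X Y a b e : ((pullback n H X Y)`_a`_b).[e] =
  \sum_(i < n) \sum_(j < n) H i j * ((X ^+ i * Y ^+ j)`_a`_b).[e].
Proof.
rewrite !coef_sum horner_sum; apply: eq_bigr => i _.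
rewrite !coef_sum horner_sum; apply: eq_bigr => j _.
by rewrite !coefCM hornerM hornerC.
Qed.

(** The two sums have different ranges; [X^i Y^j] has order at least [i + j], so the additional
    terms vanish. *)
Lemma agree2_comp n (H : fps2 K) (Phi : formal_map K) : fixes_origin Phi ->
  agree2 1 n.+1 (fps2_comp H Phi)
    (pullback n.+1 H (rescale n.+1 Phi.1) (rescale n.+1 Phi.2)).
Proof.
move=> [Phi1 Phi2] a b hab; rewrite pullback_coef /fps2_comp.
set X := rescale _ Phi.1; set Y := rescale _ Phi.2.
have XY i j : fps2_mul (fps2_pow Phi.1 i) (fps2_pow Phi.2 j) a b =
    ((X ^+ i * Y ^+ j)`_a`_b).[1].
  by apply: agree2M hab; apply: agree2X; exact: agree2_rescale1.
have XY0 i j : (a + b < i + j)%N -> ((X ^+ i * Y ^+ j)`_a`_b).[1] = 0.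
  move=> abij; have := vanish2M (vanish2X (n := i) (rescale_vanish n Phi1))
    (vanish2X (n := j) (rescale_vanish n Phi2)).
  by rewrite !mul1n => -> //; rewrite horner0.
under eq_bigr => i _ do under eq_bigr => j _ do rewrite XY.
rewrite (big_ord_widen n.+1 (fun i => \sum_(j < (a + b).+1)
  H i j * ((X ^+ i * Y ^+ j)`_a`_b).[1])) // [LHS]big_mkcond.
apply: eq_bigr => i _ /=; case: ltnP => hi; last first.
  by rewrite big1 // => j _; rewrite XY0 ?mulr0 //; lia.
rewrite (big_ord_widen n.+1 (fun j => H i j * ((X ^+ i * Y ^+ j)`_a`_b).[1])) //.
rewrite big_mkcond; apply: eq_bigr => j _ /=; case: ltnP => // hj.
by rewrite XY0 ?mulr0 //; lia.
Qed.

(** At [eps = 0] only the terms with [(a + b).-1 = 0] survive: the constant term, which is 0, and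
    the linear part, which is the identity. *)
Lemma agree2_rescale0 n (Phi : formal_map K) :
  fixes_origin Phi -> identity_differential Phi ->
  agree2 0 n fps2_x (rescale n Phi.1) /\ agree2 0 n fps2_y (rescale n Phi.2).
Proof.
move=> [Phi1 Phi2] [Phi110 Phi101 Phi210 Phi201].
split=> -[|[|a]] [|[|b]] hab; rewrite coef_rescale // hornerZ hornerXn
  ?Phi1 ?Phi2 ?Phi110 ?Phi101 ?Phi210 ?Phi201 /fps2_x /fps2_y ?eqxx ?andbF
  ?addn0 ?add0n ?addSn ?addnS /= ?expr0n ?expr0 ?mul0r ?mulr0 ?mulr1 //.
Qed.

Lemma agree2_pullback0 n (H : fps2 K) (Phi : formal_map K) :
  fixes_origin Phi -> identity_differential Phi ->
  agree2 0 n H (pullback n H (rescale n Phi.1) (rescale n Phi.2)).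
Proof.
move=> Phi0 PhiD a b hab; have [Xx Yy] := agree2_rescale0 n Phi0 PhiD.
rewrite pullback_coef.
have XY i j : (((rescale n Phi.1) ^+ i * (rescale n Phi.2) ^+ j)`_a`_b).[0] =
    ((a == i) && (b == j))%:R.
  rewrite -(agree2M (agree2X i Xx) (agree2X j Yy) hab).
  rewrite (agree2M (agree2X i (@agree2_x 0 _)) (agree2X j (@agree2_y 0 _)) hab).
  by rewrite monomial_coef horner_natb.
under eq_bigr => i _ do under eq_bigr => j _ do rewrite XY.
have an : (a < n)%N by lia.
have bn : (b < n)%N by lia.
rewrite (bigD1 (Ordinal an)) //= [X in _ + X]big1 => [|i ia]; last first.
  rewrite big1 // => j _; suff /negPf -> : a != i by rewrite mulr0.
  by apply: contra ia => /eqP ai; apply/eqP/val_inj.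
rewrite addr0 (bigD1 (Ordinal bn)) //= big1 => [|j jb]; last first.
  suff /negPf -> : b != j by rewrite andbF mulr0.
  by apply: contra jb => /eqP bj; apply/eqP/val_inj.
by rewrite !eqxx mulr1 addr0.
Qed.

Lemma vanish2_embed c d p : vanish2 d p -> vanish2 d (embed c * p).
Proof. exact: (vanish2M (vanish2_0 _)). Qed.

Lemma pullback_vanish n lam (Hs : fps2 K) (Phi : formal_map K) :
  fixes_origin Phi -> identity_differential Phi -> O3 Hs -> (1 < n)%N ->
  vanish2 3 (pullback n (fps2_add (quadratic lam) Hs)
    (rescale n Phi.1) (rescale n Phi.2) - embed lam * xy K).
Proof.
move=> Phi0 [Phi110 Phi101 Phi210 Phi201] Hs3; case: n => [//|n] n1.
set X := rescale _ Phi.1; set Y := rescale _ Phi.2.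
have X1 : vanish2 1 X by apply: rescale_vanish; case: Phi0.
have Y1 : vanish2 1 Y by apply: rescale_vanish; case: Phi0.
have x1 : vanish2 1 ('X : B).
  move=> [|a] [|b] // _; have := monomial_coef 1 0 0 0.
  by rewrite expr1 expr0 mulr1 => ->.
have Xx : vanish2 2 (X - 'X).
  move=> a b hab; rewrite !coefB coef_rescale; last by lia.
  have := monomial_coef 1 0 a b; rewrite expr1 expr0 mulr1 => ->.
  case: a b hab => [|[|a]] [|[|b]] //= _;
    by rewrite ?(proj1 Phi0) ?Phi110 ?Phi101 ?scale0r ?scale1r ?expr0 ?subrr.
have Yy : vanish2 2 (Y - ('X)%:P).
  move=> a b hab; rewrite !coefB coef_rescale; last by lia.
  have := monomial_coef 0 1 a b; rewrite expr1 expr0 mul1r => ->.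
  case: a b hab => [|[|a]] [|[|b]] //= _;
    by rewrite ?(proj2 Phi0) ?Phi210 ?Phi201 ?scale0r ?scale1r ?expr0 ?subrr.
(* Write [X Y - x y = (X - x) Y + x (Y - y)]: both products have order at least 2 + 1, and the
   pullback of [Hs] has order at least 3. *)
have -> : pullback n.+1 (fps2_add (quadratic lam) Hs) X Y - embed lam * xy K =
    embed lam * ((X - 'X) * Y + 'X * (Y - ('X)%:P)) + pullback n.+1 Hs X Y.
  have -> : pullback n.+1 (fps2_add (quadratic lam) Hs) X Y =
      embed lam * (X * Y) + pullback n.+1 Hs X Y.
    have -> : embed lam * (X * Y) = pullback n.+1 (quadratic lam) X Y.
      rewrite /pullback (bigD1 (Ordinal n1)) //= [X in _ + X]big1 => [|i i1]; last first.
        rewrite big1 // => j _; rewrite quadraticE.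
        suff /negPf -> : (i : nat) != 1%N by rewrite /embed !polyC0 mul0r.
        by apply: contra i1 => /eqP i1; apply/eqP/val_inj.
      rewrite addr0 (bigD1 (Ordinal n1)) //= big1 => [|j j1]; last first.
        rewrite quadraticE.
        suff /negPf -> : (j : nat) != 1%N by rewrite andbF /embed !polyC0 mul0r.
        by apply: contra j1 => /eqP j1; apply/eqP/val_inj.
      by rewrite addr0 quadraticE !expr1.
    rewrite /pullback -big_split; apply: eq_bigr => i _ /=.
    rewrite -big_split; apply: eq_bigr => j _ /=.
    by rewrite /embed /fps2_add !polyCD mulrDl.
  by rewrite /xy; ring.
apply: vanish2D.
  apply/vanish2_embed/vanish2D; first exact: (vanish2M Xx Y1).
  exact: (vanish2M x1 Yy).
apply: vanish2_sum => i; apply: vanish2_sum => j.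
have [ij|ij] := ltnP (i + j) 3.
  by rewrite Hs3 // /embed !polyC0 mul0r => a b _; rewrite !coef0.
apply: (vanish2W ij); apply: vanish2_embed.
by have := vanish2M (vanish2X (n := i) X1) (vanish2X (n := j) Y1); rewrite !mul1n.
Qed.

(** This is [L_k 1] for [P = lam x y + G], written directly on series. *)
Definition action_coef (lam : K) (M k : nat) G : K :=
  \sum_(m < M.+1) weight lam m k * fps2_pow G m (m + k)%N (m + k)%N.

Lemma horner_laplace lam e n M k G p : agree2 e n G p -> (2 * (M + k) < n)%N ->
  (laplace lam diag p M.+1 k 1).[e] = action_coef lam M k G.
Proof.
move=> Gp hn; rewrite /laplace horner_sum; apply: eq_bigr => m _.
rewrite hornerZ mul1r diagE -(agree2X m Gp) //.
by have := ltn_ord m; lia.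
Qed.

Lemma deriv0_horner (p : {poly K}) x y : deriv p = 0 -> p.[x] = p.[y].
Proof.
move=> p'0; suff -> : p = (p`_0)%:P by rewrite !hornerC.
apply/polyP => -[|i]; rewrite coefC //=.
have := congr1 (fun q : {poly K} => q`_i) p'0; rewrite coef_deriv coef0 => /eqP.
by rewrite mulrn_eq0 /= => /eqP.
Qed.

(** Along the homotopy [L_k 1] is a polynomial in [eps] with zero derivative; the two sides are its
    values at 0 and 1. *)
Lemma action_coef_invariant lam (Hs : fps2 K) (Phi : formal_map K) M k :
  lam != 0 -> O3 Hs ->
  fixes_origin Phi -> identity_differential Phi -> symplectic Phi ->
  (2 * k + 3 <= M)%N ->
  action_coef lam M k Hs = action_coef lam M k
    (fps2_add (fps2_comp (fps2_add (quadratic lam) Hs) Phi) (fps2_opp (quadratic lam))).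
Proof.
(* With this [n], the Jacobian is 1 below degree [n - 1 = 2 (M + k) + 3], as [laplace_homotopy]
   requires. *)
move=> lam_neq0 Hs3 Phi0 PhiD PhiJ kM; pose n := (2 * (M + k) + 4)%N.
set H := fps2_add (quadratic lam) Hs.
pose P := pullback n H (rescale n Phi.1) (rescale n Phi.2).
have Pn : n = n.-1.+1 by rewrite /n addnS.
have HsP : agree2 0 n Hs (P - embed lam * xy K).
  move=> a b hab; have := agree2B (agree2_pullback0 H Phi0 PhiD)
    (@agree2_quadratic 0 n lam) hab.
  by move=> <-; rewrite /H /fps2_add /fps2_opp addrAC subrr add0r.
have NP : agree2 1 n (fps2_add (fps2_comp H Phi) (fps2_opp (quadratic lam)))
    (P - embed lam * xy K).
  by apply: agree2B (@agree2_quadratic 1 n lam); rewrite /P Pn; apply: agree2_comp.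
rewrite -(horner_laplace lam HsP) ?/n; last by lia.
rewrite -(horner_laplace lam NP) ?/n; last by lia.
apply: deriv0_horner; apply: laplace_homotopy => //.
  by apply: pullback_vanish => //; rewrite /n; lia.
have -> : (2 * (M + k) + 3 = n.-1)%N by rewrite /n; lia.
exact: jacobian_rescale.
Qed.

End Invariance.

(** * The action series *)

Section ActionSeries.
Context {K : numFieldType}.
Implicit Types (f g : fps K) (G : fps2 K) (lam : K).

(** The partial sums are constant from [M] on, and two eventual values coincide at a common index,
    so [xget] has a single candidate. *)
Lemma fps_sum_eventually (u : nat -> fps K) k M : (0 < M)%N ->
  (forall m, (M <= m)%N -> u m k = 0) -> fps_sum u k = \sum_(1 <= m < M) u m k.
Proof.
move=> M0 uM; apply: xget_subset1.
  exists M => // n /= Mn; rewrite (@big_cat_nat _ _ _ M) //=.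
  rewrite [X in _ + X]big_nat_cond [X in _ + X]big1 ?addr0 // => m.
  by rewrite andbT => /andP[/uM].
move=> c c' hc hc'.
by have [n [<- <-]] := filter_ex (filterI hc hc').
Qed.

Lemma iter_fps_deriv j f k :
  iter j (@fps_deriv K) f k *+ k`! = f (k + j)%N *+ (k + j)`!.
Proof.
elim: j k => [|j IH] k; first by rewrite addn0.
by rewrite iterS {1}/fps_deriv -mulrnA -factS IH addSnnS.
Qed.

Lemma fps2_pow_O3 G m a b : O3 G -> (a + b < 3 * m)%N -> fps2_pow G m a b = 0.
Proof.
move=> G3; elim: m a b => [|m IH] a b hab; first by rewrite muln0 in hab.
rewrite /fps2_pow iterS -/(fps2_pow G m) /fps2_mul big1 // => i _.
rewrite big1 // => j _.
have [hij|hij] := ltnP (i + j) 3; first by rewrite G3 ?mul0r.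
by rewrite IH ?mulr0 //; have := ltn_ord i; have := ltn_ord j; lia.
Qed.

(** For [a < 2] both sides are 0: the degree [2 a] is at most 2, below the order of the power. *)
Lemma average_pow G m a : O3 G -> average (fps2_pow G m.+1) a = fps2_pow G m.+1 a a.
Proof.
move=> G3; rewrite /average; case: ltnP => // a2.
by rewrite fps2_pow_O3 //; lia.
Qed.

Lemma of_xyM f g : fps2_mul (of_xy f) (of_xy g) = of_xy (fps_mul f g).
Proof.
apply/funext => a; apply/funext => b; rewrite /fps2_mul /of_xy /fps_mul.
case: eqP => [<-|ab].
  apply: eq_bigr => i _; rewrite (bigD1 i) //= !eqxx big1 ?addr0 // => j ji.
  suff /negPf -> : (i : nat) != j by rewrite mul0r.
  by apply: contra ji => /eqP ij; apply/eqP/val_inj.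
rewrite big1 // => i _; rewrite big1 // => j _.
case: eqP => [ij|]; last by rewrite mul0r.
case: eqP => [abij|]; last by rewrite mulr0.
by have := ltn_ord i; have := ltn_ord j; lia.
Qed.

Lemma of_xy_pow f m : fps2_pow (of_xy f) m = of_xy (fps_pow f m).
Proof.
elim: m => [|m IH].
  apply/funext => a; apply/funext => b.
  rewrite /fps2_pow /= /fps2_one /of_xy /fps_pow /= /fps_one.
  case: (eqVneq a b) => [<-|ab]; first by rewrite andbb.
  by case: andP => // -[/eqP a0 /eqP b0]; rewrite a0 b0 in ab.
by rewrite /fps2_pow iterS -/(fps2_pow _ m) IH of_xyM.
Qed.

Variables (lam : K) (Hs : fps2 K).
Hypotheses (lam_neq0 : lam != 0) (Hs3 : O3 Hs).

(** The candidate inverse: it recovers the action [x y] from the energy [w]. *)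
Definition action_series : fps K :=
  fps_scale lam^-1 (fps_sub fps_var (fps_dilate lam^-1 (Sseries lam Hs))).

Lemma action_series0 : action_series 0%N = 0.
Proof.
rewrite /action_series /fps_scale /fps_sub /fps_dilate /fps_var /= expr0 mul1r sub0r.
rewrite /Sseries (@fps_sum_eventually _ _ 1) // => [|[|m] // _].
  by rewrite big_geq // oppr0 mulr0.
rewrite /fps_scale /=; have := iter_fps_deriv m (average (fps2_pow Hs m.+1)) 0.
rewrite fact0 mulr1n => ->.
by rewrite average_pow // fps2_pow_O3 ?mul0rn ?mulr0 //; lia.
Qed.

(** The derivative of order [m - 1] supplies [(m + k)! / (k + 1)!], and the prefactor, the dilation
    and [lam^(m - 1)] together give [lam^(- (m + k + 1))]; this is [weight m k]. *)
Lemma action_seriesS M k : (2 * k + 3 <= M)%N ->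
  action_series k.+1 * k.+1`!%:R = action_coef lam M k Hs.
Proof.
move=> kM; rewrite /action_series /fps_scale /fps_sub /fps_dilate /fps_var.
have term m :
    ((-1) ^+ m / (lam ^+ m * m.+1`!%:R) *
      iter m (@fps_deriv K) (average (fps2_pow Hs m.+1)) k.+1) * k.+1`!%:R =
    (-1) ^+ m / (lam ^+ m * m.+1`!%:R) *
      (fps2_pow Hs m.+1 (m.+1 + k)%N (m.+1 + k)%N * (m.+1 + k)`!%:R).
  rewrite -mulrA; congr (_ * _).
  have -> : (m.+1 + k = k.+1 + m)%N by lia.
  by rewrite !mulr_natr iter_fps_deriv average_pow.
rewrite /Sseries (@fps_sum_eventually _ _ M.+1) // => [|[|m] // Mm]; last first.
  apply: (mulIf (x := k.+1`!%:R)); first by rewrite pnatr_eq0 -lt0n fact_gt0.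
  by rewrite /fps_scale term fps2_pow_O3 ?mul0r ?mulr0 //; lia.
(* The term [m = 0] corresponds to [w / lam], the terms [m >= 1] to [S[H]]. *)
rewrite /action_coef big_ord_recl -mulrA mulrBl mulrBr; congr (_ + _).
  rewrite /weight /= /fps2_one add0n; case: k {kM term} => [|k].
    by rewrite /= !expr0 expr1 fact0 divr1 !mulr1 mul1r.
  by rewrite /= mul0r !mulr0.
rewrite big_add1 big_mkord -mulrA mulr_suml !mulr_sumr -sumrN.
apply: eq_bigr => m _; rewrite /fps_scale lift0 [m.+1.-1]/= term.
rewrite /weight.
have fact_neq0 : m.+1`!%:R != 0 :> K by rewrite pnatr_eq0 -lt0n fact_gt0.
rewrite addSn -addnS [lam ^+ (m + k.+1).+1]exprS [lam ^+ (m + k.+1)]exprD.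
rewrite [(-1) ^+ m.+1]exprS exprVn.
have := expf_neq0 m lam_neq0; set l := lam ^+ m => l_neq0.
have := expf_neq0 k.+1 lam_neq0; set l' := lam ^+ k.+1 => l'_neq0.
by field; rewrite fact_neq0 l_neq0 l'_neq0 lam_neq0.
Qed.

(** By invariance the coefficients may be computed from the normal form, where the diagonal
    coefficients of [(nu (x y) - lam x y)^m] are those of a one-variable power. This gives a left
    inverse, which is then two-sided. *)
Lemma action_series_inverse (nu : fps K) (Phi : formal_map K) :
  fixes_origin Phi -> identity_differential Phi -> symplectic Phi ->
  of_xy nu = fps2_comp (fps2_add (quadratic lam) Hs) Phi ->
  O3 (fps2_add (of_xy nu) (fps2_opp (quadratic lam))) ->
  fps_comp_inverse nu action_series.
Proof.
move=> Phi0 PhiD PhiJ nuE N3.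
have nu0 : nu 0%N = 0.
  have := N3 0%N 0%N isT; rewrite /fps2_add /fps2_opp quadraticE /of_xy /=.
  by rewrite mulr0n subr0.
have nu1 : nu 1%N = lam.
  have := N3 1%N 1%N isT; rewrite /fps2_add /fps2_opp quadraticE /of_xy /=.
  by rewrite mulr1n => /eqP; rewrite subr_eq0 => /eqP.
have g_nu : fps_comp action_series nu = fps_var.
  (* This [M] serves all indices up to [k] at once; truncating [Ns] after degree [M + k] keeps every
     coefficient that is read. *)
  apply/funext => k; pose M := (2 * k + 3)%N.
  pose Ns : {poly K} := \poly_(i < (M + k).+1) (nu i - lam *+ (i == 1%N)).
  have Ns2 : vanish1 2 Ns.
    by move=> [|[|i]] // _; rewrite coef_poly ?nu0 ?nu1 subrr ?if_same.
  have NE : fps2_add (of_xy nu) (fps2_opp (quadratic lam)) =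
      of_xy (fun i => nu i - lam *+ (i == 1%N)).
    apply/funext => a; apply/funext => b; rewrite /fps2_add /fps2_opp quadraticE /of_xy.
    case: (eqVneq a b) => [<-|ab]; first by rewrite andbb.
    case: andP => [[/eqP a1 /eqP b1]|_]; first by rewrite a1 b1 in ab.
    by rewrite subrr.
  have nuNs : agree1 k.+1 nu (lam *: 'X + Ns).
    move=> i ik; rewrite coefD coefZ coefX coef_poly.
    have -> : (i < (M + k).+1)%N by lia.
    by rewrite mulr_natr [RHS]addrC subrK.
  rewrite (fps_comp_coef _ nuNs) //.
  apply: (laplace_inverse lam_neq0 Ns2 (M := M)) => //.
  - by rewrite /M; lia.
  - exact: action_series0.
  - move=> j jk; rewrite (@action_seriesS M); last by rewrite /M; lia.
    rewrite (action_coef_invariant lam_neq0 Hs3 Phi0 PhiD PhiJ); last by rewrite /M; lia.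
    rewrite -nuE NE /action_coef /laplace; apply: eq_bigr => m _ /=.
    rewrite mul1r of_xy_pow /of_xy eqxx; congr (_ * _).
    symmetry; apply: (agree1X m (agree1_poly (n := (M + k).+1) _)).
    by have := ltn_ord m; lia.
split=> //; first exact: action_series0.
by apply: fps_comp_left_inverse g_nu => //; [exact: action_series0 | rewrite nu1].
Qed.

End ActionSeries.

Theorem theorem1 (R : realType) (lam : R[i]) (Hs : fps2 R[i]) (nu : fps R[i])
    (lam_neq0 : lam != 0)
    (Hs_O3 : O3 Hs)
    (nu_normal : normal_form lam (fps2_add (quadratic lam) Hs) (of_xy nu)) :
  fps_comp_inverse nu
    (fps_scale lam^-1 (fps_sub fps_var (fps_dilate lam^-1 (Sseries lam Hs)))).
Proof.
have [Phi [[Phi0 PhiD PhiJ _] nuE N3 _]] := nu_normal.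
exact: (action_series_inverse (K := R[i]) lam_neq0 Hs_O3 Phi0 PhiD PhiJ).
Qed.
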